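(* Let $I\subset\mathbf k[\mathbf x]$ be a monomial ideal with cofinite support and $x_i\notin I$ for all $i$, and let $E_{\min}\subseteq E\cap\mathcal R(I)$ be a set of minimal roots as defined in the context. Then the Lie algebra $\mathfrak g=\operatorname{Der}_{\mathbf k}(\mathbf k[\mathbf x]/I)$ is generated by $\mathfrak t\cup\bigcup_\alpha\mathfrak g_\alpha$, where $\alpha$ ranges over all outer roots, all inner roots $e_i$ with $e_i\in E_{\min}$, and all irreducible roots of the form $2e_i$.
   Context: Setting: $\mathbf k$ is an algebraically closed field of characteristic zero, $n\ge1$, $M=\mathbb Z^n$ with canonical basis $E=\{e_1,\dots,e_n\}$, and $N_{\mathbf k}=\operatorname{Hom}(M,\mathbf k)\cong\mathbf k^n$ with dual basis $e_1^*,\dots,e_n^*$. $\mathbf k[\mathbf x]=\mathbf k[x_1,\dots,x_n]$ and $\mathbf x^m=x_1^{m_1}\cdots x_n^{m_n}$. For a monomial ideal $I$, $\operatorname{supp}(I)=\{m\in\mathbb Z^n_{\ge0}:\mathbf x^m\in I\}$; $I$ has cofinite support if $\mathbb Z^n_{\ge0}\setminus\operatorname{supp}(I)$ is finite. Set $A=\mathbf k[\mathbf x]/I$. For $\alpha\in\mathbb Z^n$ and $p\in N_{\mathbf k}$, $\partial_{\alpha,p}$ denotes the homogeneous derivation $\mathbf x^m\mapsto p(m)\mathbf x^{m+\alpha}$ of $\mathbf k[\mathbf x]$ (whenever it maps $\mathbf k[\mathbf x]$ to itself), and $\overline\partial_{\alpha,p}$ the derivation induced on $A$ when $\partial_{\alpha,p}(I)\subseteq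 I$. A degree $\alpha$ is inner if $\alpha\in\mathbb Z_{\ge0}^n$ and outer otherwise. Put $E_\alpha=\{e_i\in E : \alpha+e_i\in\mathbb Z^n_{\ge0}\setminus\operatorname{supp}(I)\}$. A root is a degree $\alpha\ne0$ for which there is a nonzero homogeneous derivation of $A$ of degree $\alpha$; $\mathcal R(I)$ is the set of roots. Explicitly, an inner $\alpha\neq 0$ is a root iff $E_\alpha\neq\varnothing$; an outer $\alpha$ is a root iff it has exactly one negative coordinate, say $\alpha_k=-1$, for every $\beta\in\operatorname{supp}(I)$ either $\alpha+\beta\in\operatorname{supp}(I)$ or $\alpha+\beta\notin\mathbb Z^n_{\ge0}$, and $E_\alpha\ne\varnothing$ (then $E_\alpha=\{e_k\}$). $N(\alpha)=\bigoplus_{e_i\in E_\alpha}\mathbf k e_i^*$ for inner roots, $N(\alpha)=\mathbf k e_k^*$ for outer roots with $\alpha_k=-1$. $\mathfrak g=\operatorname{Der}_{\mathbf k}(A)=\mathfrak t\oplus\bigoplus_{\alpha\in\mathcal R(I)}\mathfrak g_\alpha$ with $\mathfrak g_\alpha=\{\overline\partial_{\alpha,p}:p\in N(\alpha)\}$ and $\mathfrak t=\mathfrak g_0=\{\overline\partial_{0,p}:p\in N_{\mathbf k}\}$. For a root $\gamma$, $B_\gamma=\sum[\mathfrak g_\alpha,\mathfrak g_\beta]$, sum over $\alpha,\beta\in\mathcal R(I)$ with $\alpha+\beta=\gamma$; $\gamma$ is reducible if $B_\gamma=\mathfrak g_\gamma$ and irreducible otherwise. Write $e_i\succ e_j$ if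 $e_i-e_j\in\mathcal R(I)$. A set of minimal roots is a subset $E_{\min}\subseteq E\cap\mathcal R(I)$ such that for every $e_k\in E\cap\mathcal R(I)$ there is $e_i\in E_{\min}$ with $e_k\succ e_i$ or $e_k=e_i$, and such that there is no relation $e_j\succ e_i$ with $e_i,e_j\in E_{\min}$ distinct. *)

(* Defs.v *)
From HB Require Import structures.
From mathcomp Require Import all_boot all_order all_algebra.
From mathcomp Require Import mpoly.

Set Implicit Arguments.
Unset Strict Implicit.
Unset Printing Implicit Defensive.

Import Order.TTheory GRing.Theory Num.Theory.
Local Open Scope ring_scope.
Local Open Scope quotient_scope.

(* [idealr] bundles properness; below this is implied by x_i \notin I and
   n >= 1. *)
Definition quotalg (n : nat) (k : fieldType) (I : idealr {mpoly k[n]}) : Type :=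
  {ideal_quot I}.

Section QuotientAlgebra.
Variables (n : nat) (k : fieldType) (I : idealr {mpoly k[n]}).
Local Notation A := (quotalg I).

HB.instance Definition _ := GRing.ComNzRing.on A.

Definition qpi : {mpoly k[n]} -> A := \pi_({ideal_quot I}).

Definition qscale (c : k) (a : A) : A := qpi c%:MP * a.

Lemma qpi1 : qpi 1 = 1. Proof. exact: (rmorph1 \pi_({ideal_quot I})). Qed.
Lemma qpiD f g : qpi (f + g) = qpi f + qpi g.
Proof. exact: (rmorphD \pi_({ideal_quot I})). Qed.
Lemma qpiM f g : qpi (f * g) = qpi f * qpi g.
Proof. exact: (rmorphM \pi_({ideal_quot I})). Qed.

Fact qscaleA c d a : qscale c (qscale d a) = qscale (c * d) a.
Proof. by rewrite /qscale mulrA -qpiM mpolyCM. Qed.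
Fact qscale1 : left_id 1 qscale.
Proof. by move=> a; rewrite /qscale mpolyC1 qpi1 mul1r. Qed.
Fact qscaleDr : right_distributive qscale +%R.
Proof. by move=> c a b; rewrite /qscale mulrDr. Qed.
Fact qscaleDl a : {morph qscale^~ a : c d / c + d}.
Proof. by move=> c d; rewrite /qscale mpolyCD qpiD mulrDl. Qed.

HB.instance Definition _ :=
  GRing.Zmodule_isLmodule.Build k A qscaleA qscale1 qscaleDr qscaleDl.

Fact qscaleAl c (a b : A) : c *: (a * b) = (c *: a) * b.
Proof. exact: mulrA. Qed.

HB.instance Definition _ := GRing.Lmodule_isLalgebra.Build k A qscaleAl.

End QuotientAlgebra.

Section Lattice.
Variables (n : nat).

Definition nonneg (z : 'rV[int]_n) : bool := [forall i, 0 <= z 0 i].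

Definition e_ (i : 'I_n) : 'rV[int]_n := delta_mx 0 i.

Definition zmnm (m : 'X_{1..n}) : 'rV[int]_n := \row_i (m i)%:Z.

(* Only meaningful when [nonneg z]. *)
Definition mnmz (z : 'rV[int]_n) : 'X_{1..n} := [multinom `|z 0%R i|%N | i < n].

Definition inner (alpha : 'rV[int]_n) : bool := nonneg alpha.
Definition outer (alpha : 'rV[int]_n) : bool := ~~ nonneg alpha.

End Lattice.

Section MonomialIdeals.
Variables (n : nat) (k : fieldType).
Implicit Type I : idealr {mpoly k[n]}.

Definition monomial_ideal I : Prop :=
  exists S : 'X_{1..n} -> Prop, forall f : {mpoly k[n]}, f \in I <->
    exists s : seq ({mpoly k[n]} * 'X_{1..n}),
      (forall u, u \in s -> S u.2) /\ f = \sum_(u <- s) u.1 * 'X_[u.2].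

Definition supp I (z : 'rV[int]_n) : bool := nonneg z && ('X_[mnmz z] \in I).

Definition cofinite_support I : Prop :=
  exists s : seq 'rV[int]_n, forall z, nonneg z -> ~~ supp I z -> z \in s.

(* The monomial x^z, extended by 0 to exponents outside Z_{>=0}^n. *)
Definition xmon (z : 'rV[int]_n) : {mpoly k[n]} :=
  if nonneg z then 'X_[mnmz z] else 0.

(* The pairing of N_k = Hom(Z^n, k), in the dual basis e_i^*, with Z^n. *)
Definition pairing (p : 'rV[k]_n) (m : 'rV[int]_n) : k :=
  \sum_i p 0 i * (m 0 i)%:~R.

(* The homogeneous derivation x^m |-> p(m) x^(m + alpha) of k[x]; it is the
   intended one only under [hder_stable], as otherwise [xmon] drops terms. *)
Definition hder (alpha : 'rV[int]_n) (p : 'rV[k]_n) (f : {mpoly k[n]}) :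
    {mpoly k[n]} :=
  \sum_(m <- msupp f) (f@_m * pairing p (zmnm m)) *: xmon (zmnm m + alpha).

Definition hder_stable (alpha : 'rV[int]_n) (p : 'rV[k]_n) : Prop :=
  forall m : 'X_{1..n}, pairing p (zmnm m) != 0 -> nonneg (zmnm m + alpha).

End MonomialIdeals.

Section Derivations.
Variables (k : fieldType) (A : lalgType k).
Implicit Types (D : A -> A) (S : (A -> A) -> Prop).

Definition derivation D : Prop :=
  linear D /\ forall a b, D (a * b) = D a * b + a * D b.

Definition bracket D1 D2 : A -> A := fun a => D1 (D2 a) - D2 (D1 a).

(* Maps A -> A are identified when pointwise equal. *)
Inductive lspan S : (A -> A) -> Prop :=
| lspan_gen D : S D -> lspan S D
| lspan_zero : lspan S (fun=> 0)
| lspan_add D1 D2 : lspan S D1 -> lspan S D2 -> lspan S (fun a => D1 a + D2 a)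
| lspan_scale c D : lspan S D -> lspan S (fun a => c *: D a)
| lspan_ext D D' : D =1 D' -> lspan S D -> lspan S D'.

Inductive lie_gen S : (A -> A) -> Prop :=
| lie_gen_gen D : S D -> lie_gen S D
| lie_gen_zero : lie_gen S (fun=> 0)
| lie_gen_add D1 D2 :
    lie_gen S D1 -> lie_gen S D2 -> lie_gen S (fun a => D1 a + D2 a)
| lie_gen_scale c D : lie_gen S D -> lie_gen S (fun a => c *: D a)
| lie_gen_bracket D1 D2 :
    lie_gen S D1 -> lie_gen S D2 -> lie_gen S (bracket D1 D2)
| lie_gen_ext D D' : D =1 D' -> lie_gen S D -> lie_gen S D'.

End Derivations.

Section Roots.
Variables (n : nat) (k : fieldType) (I : idealr {mpoly k[n]}).
Local Notation A := (quotalg I).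
Implicit Types (alpha beta gamma : 'rV[int]_n) (p : 'rV[k]_n) (D : A -> A).

(* The degree-z component of the Z^n-graded algebra A. *)
Definition graded_part (z : 'rV[int]_n) (a : A) : Prop :=
  exists c : k, a = c *: qpi I (xmon k z).

Definition homogeneous alpha D : Prop :=
  forall z a, graded_part z a -> graded_part (z + alpha) (D a).

Definition der_root alpha : Prop :=
  alpha != 0 /\
  exists D, [/\ derivation D, homogeneous alpha D & exists a, D a != 0].

Definition Eset alpha : {set 'I_n} :=
  [set i | nonneg (alpha + e_ i) && ~~ supp I (alpha + e_ i)].

Definition Nspace alpha p : Prop :=
  if inner alpha then forall i, i \notin Eset alpha -> p 0 i = 0
  else forall i, alpha 0 i != -1 -> p 0 i = 0.

(* D is the derivation of A induced by hder alpha p. *)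
Definition induced alpha p D : Prop :=
  [/\ hder_stable alpha p,
      forall f, f \in I -> hder alpha p f \in I &
      forall f, D (qpi I f) = qpi I (hder alpha p f)].

Definition gspace alpha D : Prop :=
  exists p, Nspace alpha p /\ induced alpha p D.

Definition torus D : Prop := exists p, induced 0 p D.

Definition Bspace gamma : (A -> A) -> Prop :=
  lspan (fun D => exists alpha beta D1 D2,
    [/\ der_root alpha, der_root beta, alpha + beta = gamma,
        gspace alpha D1 /\ gspace beta D2 & D =1 bracket D1 D2]).

Definition reducible gamma : Prop :=
  forall D, Bspace gamma D <-> gspace gamma D.

Definition succr (i j : 'I_n) : Prop := der_root (e_ i - e_ j).

Definition minimal_roots (Emin : {set 'I_n}) : Prop :=
  [/\ forall i, i \in Emin -> der_root (e_ i),
      forall l, der_root (e_ l) ->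
        exists i, i \in Emin /\ (succr l i \/ l = i) &
      forall i j, i \in Emin -> j \in Emin -> i != j -> ~ succr j i].

End Roots.

(* Main.v *)
Require Import Defs.
From HB Require Import structures.
From mathcomp Require Import all_boot all_order all_algebra.
From mathcomp Require Import mpoly ring_quotient zify ring.
From Stdlib Require Import Classical.

Set Implicit Arguments.
Unset Strict Implicit.
Unset Printing Implicit Defensive.

Import Order.TTheory GRing.Theory Num.Theory.
Local Open Scope ring_scope.

(** The quotient A has a basis of monomials, and a derivation of A is a sum of
monomial vector fields c x^m d/dx_i, each of which descends to A because I is a
monomial ideal and the characteristic is zero ([derivation_in_lie_gen]). In the
notation x^z |-> p(z) x^(z + alpha) such a field is the derivation of degree
alpha = m - e_i with p = e_i^*. It lies in the torus if alpha = 0; if alpha is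
outer it is zero or lies in an outer root space. So only the inner degrees
alpha <> 0 need an argument.

For these, write d(alpha, p) for the derivation above. The bracket formula
  [d(alpha, p), d(beta, q)] = d(alpha + beta, p(beta) q - q(alpha) p)
([bracket_induced]) is used with p fixed and q varying: if p(beta) is nonzero and
differs from p(alpha), then q |-> p(beta) q - q(alpha) p is onto, so that a single
d(alpha, p) together with all d(beta, q) produces every d(alpha + beta, r)
([reaches_sum]). With p = e_j^* the condition is alpha_j <> beta_j <> 0.

- Degree e_j: if e_j is a root outside the minimal set, some minimal e_i makes
  e_j - e_i an outer root, and e_j = (e_j - e_i) + e_i with coordinates -1 and 1
  at i ([generated_e]).
- Total degree at least 2 and not of the form 2e_j: split off some e_i. Either
  another coordinate j is nonzero, and then e_j^* separates the two summands, or
  the degree is c e_i with c >= 3, and e_i^* does ([generated_step]).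
- Degree 2e_i: the only splitting e_i + e_i does not meet the condition. If
  2e_i is an irreducible root, it is among the generators. If it is reducible,
  its root space is spanned by brackets between root spaces whose degrees add up
  to 2e_i. Cofiniteness excludes the roots -e_k, so every root has nonnegative
  coordinate sum; hence an inner factor has coordinate sum at most 2, and a
  parity argument shows that it is not some 2e_j, so the previous two cases
  apply to it ([factor_in_lie_gen], [generated_double]).

All three combine by induction on the total degree ([generated_all]). For an inner
degree alpha every p is allowed here, although the root space only uses the p
supported on E_alpha: the other coordinates of p act as zero on A
([inner_gspace]). *)

(** * Exponent vectors, monomials and the pairing *)

Section Exponents.
Variables (n : nat) (k : fieldType).
Implicit Types (z a b : 'rV[int]_n) (m : 'X_{1..n}) (p q : 'rV[k]_n).
Implicit Types (i j : 'I_n).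

Lemma nonnegP z : reflect (forall i, 0 <= z 0 i) (nonneg z).
Proof. exact: forallP. Qed.

Lemma nonnegD a b : nonneg a -> nonneg b -> nonneg (a + b).
Proof.
by move=> /nonnegP ha /nonnegP hb; apply/nonnegP=> i; rewrite mxE addr_ge0.
Qed.

Lemma e_E i j : e_ i 0 j = (i == j)%:Z.
Proof. by rewrite /e_ mxE eqxx /= eq_sym; case: eqP. Qed.

Lemma e_eq i j : e_ i 0 j = if i == j then 1 else 0.
Proof. by rewrite e_E; case: eqP. Qed.

Lemma nonneg_zmnm m : nonneg (zmnm m).
Proof. by apply/nonnegP=> i; rewrite mxE. Qed.

Lemma zmnmK : cancel (@zmnm n) (@mnmz n).
Proof. by move=> m; apply/mnmP=> i; rewrite mnmE mxE absz_nat. Qed.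

Lemma mnmzK z : nonneg z -> zmnm (mnmz z) = z.
Proof.
by move=> /nonnegP hz; apply/rowP=> i; rewrite mxE mnmE gez0_abs.
Qed.

Lemma zmnmD m1 m2 : zmnm (m1 + m2) = zmnm m1 + zmnm m2.
Proof. by apply/rowP=> i; rewrite !mxE mnmDE PoszD. Qed.

Lemma subm_self m : (m - m = 0)%MM.
Proof. by apply/mnmP=> i; rewrite mnmBE mnm0E subnn. Qed.

Lemma zmnm1 i : zmnm U_(i) = e_ i.
Proof. by apply/rowP=> j; rewrite e_E mxE mnm1E; case: eqP. Qed.

Lemma nonneg_e i : nonneg (e_ i : 'rV_n).
Proof. by rewrite -zmnm1 nonneg_zmnm. Qed.

Lemma xmon_zmnm m : xmon k (zmnm m) = 'X_[m].
Proof. by rewrite /xmon nonneg_zmnm zmnmK. Qed.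

Lemma xmonD a b :
  nonneg a -> nonneg b -> xmon k (a + b) = xmon k a * xmon k b.
Proof.
move=> ha hb; rewrite -(mnmzK ha) -(mnmzK hb) -zmnmD !xmon_zmnm.
exact: mpolyXD.
Qed.

Lemma pairingDr p a b : pairing p (a + b) = pairing p a + pairing p b.
Proof.
rewrite /pairing -big_split; apply: eq_bigr => i _ /=.
by rewrite mxE intrD mulrDr.
Qed.

Lemma pairingDl p q a : pairing (p + q) a = pairing p a + pairing q a.
Proof.
rewrite /pairing -big_split; apply: eq_bigr => i _ /=.
by rewrite mxE mulrDl.
Qed.

Lemma pairingZl c p a : pairing (c *: p) a = c * pairing p a.
Proof.
rewrite /pairing big_distrr; apply: eq_bigr => i _ /=.
by rewrite mxE mulrA.
Qed.

Lemma pairing_e p i : pairing p (e_ i) = p 0 i.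
Proof.
rewrite /pairing (bigD1 i) //= e_E eqxx mulr1 big1 ?addr0 // => j ji.
by rewrite e_E eq_sym (negbTE ji) mulr0.
Qed.

Lemma pairing_delta i a : pairing (delta_mx 0 i : 'rV[k]_n) a = (a 0 i)%:~R.
Proof.
rewrite /pairing (bigD1 i) //= mxE !eqxx mul1r big1 ?addr0 // => j ji.
by rewrite mxE (negbTE ji) andbF mul0r.
Qed.

End Exponents.

(** * Polynomial vector fields *)

Section VectorFields.
Variables (n : nat) (k : fieldType).
Implicit Types (z a b : 'rV[int]_n) (m : 'X_{1..n}) (p q : 'rV[k]_n).
Implicit Types (i j : 'I_n).
Implicit Types (f g : {mpoly k[n]}) (v : 'I_n -> {mpoly k[n]}).

Definition vfield v f : {mpoly k[n]} := \sum_i v i * f^`M(i).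

Lemma vfield_linear v : linear (vfield v).
Proof.
move=> c f g; rewrite /vfield scaler_sumr -big_split; apply: eq_bigr => i _ /=.
by rewrite mderivD mderivZ mulrDr scalerAr.
Qed.

HB.instance Definition _ v :=
  GRing.isLinear.Build k {mpoly k[n]} {mpoly k[n]} _ (vfield v)
    (vfield_linear v).

Lemma vfieldM v f g : vfield v (f * g) = vfield v f * g + f * vfield v g.
Proof.
rewrite /vfield big_distrl big_distrr -big_split; apply: eq_bigr => i _ /=.
by rewrite mderivM; ring.
Qed.

Lemma vfieldXi v i : vfield v 'X_i = v i.
Proof.
rewrite /vfield (bigD1 i) //= mderivX mnm1E eqxx scale1r big1 => [|j ji].
  by rewrite subm_self mpolyX0 mulr1 addr0.
by rewrite mderivX mnm1E eq_sym (negbTE ji) scale0r mulr0.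
Qed.

(** The coefficients of d(alpha, p) = sum_i p_i x^(alpha + e_i) d/dx_i. *)
Definition hcoef a p (i : 'I_n) : {mpoly k[n]} := p 0 i *: xmon k (a + e_ i).

Lemma hderX a p m : hder a p 'X_[m] = pairing p (zmnm m) *: xmon k (zmnm m + a).
Proof. by rewrite /hder msuppX big_seq1 mcoeffX eqxx mul1r. Qed.

(** Euler's identity: x_i d/dx_i multiplies x^m by m_i. Stability makes
alpha + e_i a genuine exponent whenever p_i is nonzero, so that no term of the
vector field is cut off by [xmon]. The right-hand side makes it visible that
[hder] is linear and satisfies the Leibniz rule. *)
Lemma hder_vfield a p : hder_stable a p -> hder a p =1 vfield (hcoef a p).
Proof.
move=> st f; rewrite [in RHS](mpolyE f) linear_sum; apply: eq_bigr => m _ /=.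
rewrite linearZ -scalerA; congr (_ *: _).
rewrite /pairing /vfield scaler_suml; apply: eq_bigr => i _.
rewrite mderivX mxE -scalerAr -scalerAl scalerA mulrC.
case: (eqVneq (p 0 i) 0) => [->|pi0]; first by rewrite mulr0 !scale0r.
case: (posnP (m i)) => [->|mi0]; first by rewrite mul0r !scale0r.
congr (_ *: _); have ai : nonneg (a + e_ i).
  by have := st U_(i)%MM; rewrite zmnm1 pairing_e addrC; apply.
rewrite -xmon_zmnm -xmonD ?nonneg_zmnm //; congr xmon.
have le_im : (U_(i) <= m)%MM.
  by apply/mnm_lepP=> j; rewrite mnm1E; case: eqP => // <-.
by rewrite -[in LHS](submK le_im) zmnmD zmnm1 -addrA addrC (addrC a).
Qed.

End VectorFields.

(** * Derivations of the quotient algebra *)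

Section Quotient.
Variables (n : nat) (k : fieldType) (I : idealr {mpoly k[n]}).
Local Notation A := (quotalg I).
Local Notation pi := (qpi I).
Implicit Types (z alpha beta : 'rV[int]_n) (m : 'X_{1..n}) (p q : 'rV[k]_n).
Implicit Types (i j : 'I_n).
Implicit Types (f g : {mpoly k[n]}) (v : 'I_n -> {mpoly k[n]}).
Implicit Types (a b : A) (D : A -> A).

Lemma qpi0E f : (pi f == 0) = (f \in I).
Proof.
have -> : 0 = pi 0 by rewrite /qpi (rmorph0 \pi_({ideal_quot I})%qT).
by rewrite -[in RHS](subr0 f); apply/esym; apply: Quotient.idealrBE.
Qed.

Lemma qpi0 f : f \in I -> pi f = 0.
Proof. by rewrite -qpi0E => /eqP. Qed.

Lemma qpiZ c f : pi (c *: f) = c *: pi f.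
Proof. by rewrite -mul_mpolyC qpiM. Qed.

Lemma qpi_linear : linear pi.
Proof. by move=> c f g; rewrite qpiD qpiZ. Qed.

HB.instance Definition _ :=
  GRing.isLinear.Build k {mpoly k[n]} A _ pi qpi_linear.

Lemma scaleqAr c a b : c *: (a * b) = a * (c *: b).
Proof. by rewrite mulrC scalerAl mulrC. Qed.

Definition lift (a : A) : {mpoly k[n]} := repr (a : {ideal_quot I}).

Lemma liftK : cancel lift pi.
Proof. by move=> a; apply: (reprK (a : {ideal_quot I})). Qed.

Lemma lift_pi f : lift (pi f) - f \in I.
Proof. by rewrite -qpi0E linearB /= liftK subrr. Qed.

Section DerivationTheory.
Variables (D : A -> A) (derD : derivation D).

Lemma der_add a b : D (a + b) = D a + D b.
Proof. by have [/(_ 1 a b)] := derD; rewrite !scale1r. Qed.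

Lemma der_0 : D 0 = 0.
Proof. by apply: (addIr (D 0)); rewrite -der_add !add0r. Qed.

Lemma der_scale c a : D (c *: a) = c *: D a.
Proof. by have [/(_ c a 0)] := derD; rewrite der_0 !addr0. Qed.

Lemma der_mul a b : D (a * b) = D a * b + a * D b.
Proof. by case: derD. Qed.

Lemma der_1 : D 1 = 0.
Proof.
have := der_mul 1 1; rewrite !mulr1 mul1r => /eqP.
by rewrite -subr_eq subrr => /eqP.
Qed.

(** The set of polynomials satisfying the identity is closed under products and
linear combinations and contains the variables. *)
Lemma der_chain f : D (pi f) = \sum_i D (pi 'X_i) * pi (f^`M(i)).
Proof.
pose P g := D (pi g) = \sum_i D (pi 'X_i) * pi (g^`M(i)).
have P1 : P 1.
  by rewrite /P qpi1 der_1 big1 // => i _; rewrite -mpolyC1 mderivC linear0 mulr0.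
have PM g h : P g -> P h -> P (g * h).
  move=> Pg Ph; rewrite /P qpiM der_mul Pg Ph big_distrl big_distrr -big_split.
  apply: eq_bigr => i _ /=.
  by rewrite mderivM linearD /= !qpiM mulrDr !mulrA (mulrC (pi g)).
have PX i : P 'X_i.
  rewrite /P (bigD1 i) //= mderivX mnm1E eqxx scale1r big1 => [|j ji].
    by rewrite subm_self mpolyX0 qpi1 mulr1 addr0.
  by rewrite mderivX mnm1E eq_sym (negbTE ji) scale0r linear0 mulr0.
have PXm m : P 'X_[m].
  rewrite mpolyXE_id; apply: big_ind => // i _.
  by elim: (m i) => [|d IH]; rewrite ?expr0 // exprS; apply: PM.
rewrite -/(P f); elim/mpolyind: f => [|c m g _ _ IH].
  by rewrite /P linear0 der_0 big1 // => i _; rewrite mderiv0 linear0 mulr0.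
rewrite /P linearP /= der_add der_scale PXm IH scaler_sumr -big_split.
by apply: eq_bigr => i _ /=; rewrite mderivD mderivZ linearP /= mulrDr scaleqAr.
Qed.

End DerivationTheory.

(** A is generated by the variables. *)
Lemma der_ext D D' : derivation D -> derivation D' ->
  (forall i, D (pi 'X_i) = D' (pi 'X_i)) -> D =1 D'.
Proof.
move=> hD hD' eqX a; rewrite -(liftK a) !der_chain //.
by apply: eq_bigr => i _; rewrite eqX.
Qed.

Lemma der_zero : derivation (fun _ : A => 0 : A).
Proof. by split=> [c a b|a b]; rewrite ?scaler0 ?mul0r ?mulr0 addr0. Qed.

Lemma der_eq D D' : D =1 D' -> derivation D -> derivation D'.
Proof. by move=> e [l m]; split=> [c a b|a b]; rewrite -!e ?l ?m. Qed.

Lemma derivation_add D D' :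
  derivation D -> derivation D' -> derivation (fun a => D a + D' a).
Proof.
move=> hD hD'; split=> [c a b|a b].
  rewrite (der_add hD) (der_add hD') (der_scale hD) (der_scale hD') scalerDr.
  exact: addrACA.
by rewrite (der_mul hD) (der_mul hD') mulrDl mulrDr addrACA.
Qed.

Lemma derivation_scale c D : derivation D -> derivation (fun a => c *: D a).
Proof.
move=> hD; split=> [d a b|a b].
  by rewrite (der_add hD) (der_scale hD) scalerDr !scalerA (mulrC c).
by rewrite (der_mul hD) scalerDr scalerAl scaleqAr.
Qed.

Lemma derivation_bracket D D' :
  derivation D -> derivation D' -> derivation (bracket D D').
Proof.
move=> hD hD'; split=> [c a b|a b]; rewrite /bracket.
  rewrite !(der_add hD, der_add hD', der_scale hD, der_scale hD').
  by rewrite scalerBr opprD addrACA.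
rewrite !(der_add hD, der_add hD', der_mul hD, der_mul hD').
by rewrite mulrBl mulrBr !opprD; ring.
Qed.

Definition stabilizes v := forall f, f \in I -> vfield v f \in I.

Definition qfield v (a : A) : A := pi (vfield v (lift a)).

Lemma qfield_pi v f : stabilizes v -> qfield v (pi f) = pi (vfield v f).
Proof.
move=> st; apply/eqP; rewrite -subr_eq0 /qfield -!linearB /= qpi0E.
exact/st/lift_pi.
Qed.

Lemma der_of_vfield v D : (forall f, D (pi f) = pi (vfield v f)) -> derivation D.
Proof.
move=> DE; split=> [c a b|a b]; rewrite -(liftK a) -(liftK b).
  by rewrite -linearP !DE linearP /= linearP.
by rewrite -qpiM !DE vfieldM linearD /= !qpiM.
Qed.

Lemma der_vfield D v : derivation D -> (forall i, D (pi 'X_i) = pi (v i)) ->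
  forall f, D (pi f) = pi (vfield v f).
Proof.
move=> hD DX f; rewrite der_chain // linear_sum /=; apply: eq_bigr => i _.
by rewrite qpiM DX.
Qed.

Lemma der_stabilizes D v : derivation D -> (forall i, D (pi 'X_i) = pi (v i)) ->
  stabilizes v.
Proof.
by move=> hD DX f fI; rewrite -qpi0E -(der_vfield hD DX) qpi0 // der_0.
Qed.

Lemma induced_derivation alpha p D : induced alpha p D -> derivation D.
Proof.
case=> st _ DE; apply: (@der_of_vfield (hcoef alpha p)) => f.
by rewrite DE hder_vfield.
Qed.

Lemma induced_Xi alpha p D i :
  induced alpha p D -> D (pi 'X_i) = p 0 i *: pi (xmon k (alpha + e_ i)).
Proof. by case=> st _ ->; rewrite hder_vfield // vfieldXi linearZ. Qed.

Lemma induced_xmon alpha p D z : induced alpha p D -> nonneg z ->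
  D (pi (xmon k z)) = pairing p z *: pi (xmon k (z + alpha)).
Proof.
case=> _ _ DE hz; rewrite -(mnmzK hz) xmon_zmnm DE hderX.
exact: linearZ.
Qed.

Lemma induced_eq alpha p D D' : D =1 D' -> induced alpha p D -> induced alpha p D'.
Proof. by move=> e [? ? DE]; split=> // f; rewrite -e. Qed.

Definition admissible alpha p :=
  hder_stable alpha p /\ forall f, f \in I -> hder alpha p f \in I.

Definition hfield alpha p : A -> A := qfield (hcoef alpha p).

Lemma induced_hfield alpha p :
  admissible alpha p -> induced alpha p (hfield alpha p).
Proof.
case=> st sI; split=> // f.
by rewrite /hfield qfield_pi ?hder_vfield // => g gI; rewrite -hder_vfield // sI.
Qed.

Lemma induced_homogeneous alpha p D : induced alpha p D -> homogeneous alpha D.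
Proof.
move=> iD z _ [c ->]; have hD := induced_derivation iD.
case: (boolP (nonneg z)) => hz.
  by exists (c * pairing p z); rewrite der_scale // (induced_xmon iD) // scalerA.
exists 0; rewrite /xmon (negbTE hz) linear0 scaler0 der_0 //.
by rewrite scale0r.
Qed.

Lemma induced_root alpha p D a : alpha != 0 -> induced alpha p D -> D a != 0 ->
  der_root I alpha.
Proof.
move=> a0 iD Da; split=> //; exists D; split.
- exact: induced_derivation iD.
- exact: induced_homogeneous iD.
by exists a.
Qed.

End Quotient.

(** * Brackets of homogeneous derivations *)

Section Generation.
Variables (n : nat) (k : fieldType) (I : idealr {mpoly k[n]}).
Local Notation A := (quotalg I).
Local Notation pi := (qpi I).
Implicit Types (z alpha beta : 'rV[int]_n) (m : 'X_{1..n}) (p q r : 'rV[k]_n).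
Implicit Types (i j l : 'I_n) (f g : {mpoly k[n]}) (v : 'I_n -> {mpoly k[n]}).
Implicit Types (a b : A) (D : A -> A) (S : (A -> A) -> Prop).

Lemma lie_gen_sum S (T : eqType) (s : seq T) (F : T -> A -> A) :
  (forall x, x \in s -> lie_gen S (F x)) -> lie_gen S (fun a => \sum_(x <- s) F x a).
Proof.
elim: s => [|x s IH] hF.
  by apply: (lie_gen_ext _ (lie_gen_zero S)) => a; rewrite big_nil.
apply: (@lie_gen_ext _ _ S (fun a => F x a + \sum_(y <- s) F y a)).
  by move=> a; rewrite big_cons.
apply: lie_gen_add; first by apply: hF; rewrite mem_head.
by apply: IH => y ys; apply: hF; rewrite inE ys orbT.
Qed.

Lemma lie_gen_derivation S D :
  (forall D', S D' -> derivation D') -> lie_gen S D -> derivation D.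
Proof.
move=> hS; elim=> {D} [D /hS //||D D' _ ? _ ?|c D _ ?|D D' _ ? _ ?|D D' e _ ?].
- exact: der_zero.
- exact: derivation_add.
- exact: derivation_scale.
- exact: derivation_bracket.
- exact: der_eq e _.
Qed.

(** Both sides are derivations, so it is enough to compare them on the
variables; there the terms p_i q_i cancel. *)
Lemma bracket_induced alpha beta p q D1 D2 D :
  induced alpha p D1 -> induced beta q D2 ->
  induced (alpha + beta) (pairing p beta *: q - pairing q alpha *: p) D ->
  D =1 bracket D1 D2.
Proof.
have comp_Xi (a b : 'rV[int]_n) (s t : 'rV[k]_n) (E E' : A -> A) i :
    induced a s E -> induced b t E' ->
    E (E' (pi 'X_i)) =
    (t 0 i * (pairing s b + s 0 i)) *: pi (xmon k (a + b + e_ i)).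
  move=> iE iE'; rewrite (induced_Xi _ iE') (der_scale (induced_derivation iE)).
  (* If t_i is nonzero, stability makes b + e_i an exponent without negative
     coordinates, so the value of E on its monomial is known. *)
  case: (eqVneq (t 0 i) 0) => [->|ti0]; first by rewrite mul0r !scale0r.
  rewrite (induced_xmon iE); last first.
    case: iE' => st _ _; have := st U_(i)%MM.
    by rewrite zmnm1 pairing_e addrC; apply.
  by rewrite pairingDr pairing_e scalerA (addrC _ a) addrA.
move=> i1 i2 iD; apply: (der_ext (induced_derivation iD)) => [|i].
  exact: derivation_bracket (induced_derivation i1) (induced_derivation i2).
rewrite /bracket (comp_Xi _ _ _ _ _ _ _ i1 i2) (comp_Xi _ _ _ _ _ _ _ i2 i1).
rewrite (induced_Xi _ iD) (addrC beta) -scalerBl !mxE; congr (_ *: _); ring.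
Qed.

(** Two maps induced by the same d(alpha, p) agree pointwise, so quantifying over
them amounts to membership of d(alpha, p) in the subalgebra, up to pointwise
equality; where d(alpha, p) does not exist the predicate is vacuous. *)
Definition reaches S alpha p := forall D, induced (I:=I) alpha p D -> lie_gen S D.

(** The map q |-> p(beta) q - q(alpha) p is surjective: it is scaling by p(beta)
modulo p, and it scales p itself by p(beta) - p(alpha). *)
Lemma reaches_sum S alpha beta p : admissible I alpha p -> reaches S alpha p ->
  (forall q, admissible I beta q) -> (forall q, reaches S beta q) ->
  pairing p beta != 0 -> pairing p alpha != pairing p beta ->
  forall r, reaches S (alpha + beta) r.
Proof.
move=> ap Lp aq Lq b0 ab r D iD.
(* Solving b q - q(alpha) p = r with q = b^-1 (r + c p) forces c = q(alpha). *)
set b := pairing p beta in b0 ab; set c := pairing r alpha / (b - pairing p alpha).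
pose q := b^-1 *: (r + c *: p).
have i1 := induced_hfield ap; have i2 := induced_hfield (aq q).
have ba0 : b - pairing p alpha != 0 by rewrite subr_eq0 eq_sym.
have qc : pairing q alpha = c.
  rewrite /q pairingZl pairingDl pairingZl /c; field.
  by rewrite b0 ba0.
have e : r = pairing p beta *: q - pairing q alpha *: p.
  by rewrite qc /q scalerA mulfV // scale1r addrK.
rewrite e in iD.
apply: (lie_gen_ext (fsym (bracket_induced i1 i2 iD))).
by apply: lie_gen_bracket; [apply: Lp i1 | apply: Lq i2].
Qed.

(** * Monomial ideals *)

Section Monomial.
Hypothesis hmon : monomial_ideal I.

Lemma idealZ c f : f \in I -> c *: f \in I.
Proof. by move=> fI; rewrite -mul_mpolyC idealMr. Qed.

Lemma mcoeffMX_eq0 f m m' : ~~ (m <= m')%MM -> (f * 'X_[m])@_m' = 0.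
Proof.
move=> mm'; apply: memN_msupp_eq0; rewrite (perm_mem (msuppMX _ _)).
by apply: contra mm' => /mapP[m1 _ ->]; rewrite lem_addr.
Qed.

(** A monomial of a combination of generators is a multiple of one of the
generating monomials. *)
Lemma ideal_monomials f m : f \in I -> f@_m != 0 -> 'X_[m] \in I.
Proof.
have [G hG] := hmon; move=> /hG[s [hs ->]]; rewrite raddf_sum /= => nz.
have [u us um] : exists2 u, u \in s & (u.1 * 'X_[u.2])@_m != 0.
  apply/hasP; apply: contraNT nz => /hasPn h; rewrite big_seq big1 // => u us.
  by apply/eqP; move: (h u us); rewrite negbK.
have le_um : (u.2 <= m)%MM.
  by apply: contraNT um => /(mcoeffMX_eq0 u.1) ->.
rewrite -(submK le_um) mpolyXD; apply: idealMr; apply/hG.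
exists [:: (1, u.2)]; split; last by rewrite big_seq1 mul1r.
by move=> w; rewrite mem_seq1 => /eqP ->; exact: (hs _ us).
Qed.

Lemma hder_ideal alpha p :
  (forall m, 'X_[m] \in I -> pairing p (zmnm m) != 0 ->
     xmon k (zmnm m + alpha) \in I) ->
  forall f, f \in I -> hder alpha p f \in I.
Proof.
move=> h f fI; rewrite /hder big_seq; apply: rpred_sum => m.
rewrite mcoeff_msupp => mf.
case: (eqVneq (pairing p (zmnm m)) 0) => [->|pm].
  by rewrite mulr0 scale0r rpred0.
by apply/idealZ/h => //; apply: ideal_monomials mf.
Qed.

Lemma xmon_ideal z z' : nonneg z -> nonneg z' -> xmon k z \in I ->
  xmon k (z + z') \in I.
Proof. by move=> hz hz' zI; rewrite xmonD // mulrC idealMr. Qed.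

Lemma inner_admissible alpha p : nonneg alpha -> admissible I alpha p.
Proof.
move=> ha; split=> [m _|]; first by rewrite nonnegD ?nonneg_zmnm.
by apply: hder_ideal => m mI _; rewrite xmon_ideal ?nonneg_zmnm ?xmon_zmnm.
Qed.

(** If i is outside E_alpha then x^(alpha + e_i) is zero in A, so the i-th
coordinate of p can be set to zero without changing the derivation. *)
Lemma inner_gspace alpha p D : nonneg alpha -> induced alpha p D -> gspace alpha D.
Proof.
move=> ha iD; pose p' : 'rV[k]_n := \row_i (if i \in Eset I alpha then p 0 i else 0).
exists p'; split; first by rewrite /Nspace /inner ha => i; rewrite mxE => /negbTE ->.
have iD' := induced_hfield (inner_admissible p' ha).
apply: (induced_eq _ iD'); apply: der_ext (induced_derivation iD') _ _.
  exact: induced_derivation iD.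
move=> i; rewrite (induced_Xi _ iD) (induced_Xi _ iD') mxE.
case: ifP => // /negP; rewrite inE => hi.
have ai := nonnegD ha (nonneg_e i).
suff -> : pi (xmon k (alpha + e_ i)) = 0 by rewrite !scaler0.
apply: qpi0; apply: contraPT hi => aI; rewrite ai /= /supp ai /= /xmon.
by move: aI; rewrite /xmon ai => ->.
Qed.

(** * Decomposition of derivations into monomial fields *)

Section CharZero.
Hypothesis hchar : [pchar k] =i pred0.

Lemma intr_char0 (z : int) : (z%:~R == 0 :> k) = (z == 0).
Proof.
have /pcharf0P h := hchar.
case: z => d; first by rewrite -pmulrn h.
by rewrite NegzE mulrNz !oppr_eq0 -pmulrn h.
Qed.

Lemma intr_inj_char0 (y z : int) : (y%:~R == z%:~R :> k) = (y == z).
Proof. by rewrite -subr_eq0 -intrB intr_char0 subr_eq0. Qed.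

Lemma reaches_sum_delta S alpha beta j :
  admissible I alpha (delta_mx 0 j) -> reaches S alpha (delta_mx 0 j) ->
  nonneg beta -> (forall q, reaches S beta q) ->
  beta 0 j != 0 -> alpha 0 j != beta 0 j ->
  forall r, reaches S (alpha + beta) r.
Proof.
move=> ad Ld hb Lb b0 ab; apply: (reaches_sum ad Ld) => // [q||].
- exact: inner_admissible.
- by rewrite pairing_delta intr_char0.
- by rewrite !pairing_delta intr_inj_char0.
Qed.

(** Each monomial vector field x^m d/dx_i occurring in a derivation of A descends
to A by itself. Let x^m' be in I with m'_i > 0. If m_i > 0, the image of x^m' under
x^m d/dx_i is a multiple of x^m'. If m_i = 0, the image of x^m' under the whole
field has x^(m' + m - e_i) among its monomials: the other components of the field
contribute only exponents whose i-th coordinate is at least m'_i, so nothing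
cancels, and the coefficient m'_i v_im is nonzero in characteristic zero. *)
Lemma monomial_field_admissible D v i m : derivation D ->
  (forall j, D (pi 'X_j) = pi (v j)) -> (v i)@_m != 0 ->
  admissible I (zmnm m - e_ i) (delta_mx 0 i).
Proof.
move=> hD DX vim.
have E m' : (0 < m' i)%N ->
    zmnm m' + (zmnm m - e_ i) = zmnm (m' - U_(i) + m)%MM.
  move=> mi; apply/rowP=> j; rewrite !mxE mnmDE mnmBE mnm1E eqxx /=.
  by rewrite (eq_sym j); case: eqP => [<-|_] /=; lia.
have pos m' : pairing (delta_mx 0 i : 'rV[k]_n) (zmnm m') != 0 -> (0 < m' i)%N.
  by rewrite pairing_delta intr_char0 mxE lt0n.
split=> [m' /pos mi|]; first by rewrite E // nonneg_zmnm.
apply: hder_ideal => m' m'I /pos mi; rewrite E // xmon_zmnm.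
case: (posnP (m i)) => mi0; last first.
  have -> : (m' - U_(i) + m)%MM = (m - U_(i) + m')%MM.
    apply/mnmP=> j; rewrite !(mnmDE, mnmBE, mnm1E).
    by case: eqP => [<-|_]; lia.
  by rewrite mpolyXD idealMr.
apply: (ideal_monomials (der_stabilizes hD DX m'I)).
rewrite /vfield raddf_sum /= (bigD1 i) //= big1 ?addr0 => [|j ji].
  rewrite mderivX -scalerAr mcoeffZ mcoeffMX mulf_neq0 //.
  by rewrite pmulrn intr_char0 -lt0n.
rewrite mderivX -scalerAr mcoeffZ mcoeffMX_eq0 ?mulr0 //.
apply/mnm_lepP => /(_ i); rewrite mnmDE !mnmBE !mnm1E eqxx (negbTE ji) mi0; lia.
Qed.

(** Written out as a sum over the monomials of lifts of the D(x_i), a derivation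
is a linear combination of the monomial fields that occur in it. *)
Lemma derivation_in_lie_gen S D : derivation D ->
  (forall D', S D' -> derivation D') ->
  (forall i m, admissible I (zmnm m - e_ i) (delta_mx 0 i) ->
     reaches S (zmnm m - e_ i) (delta_mx 0 i)) ->
  lie_gen S D.
Proof.
move=> hD hS hL; pose v i := lift (D (pi 'X_i)).
have DX i : D (pi 'X_i) = pi (v i) by rewrite liftK.
have adm i m : m \in msupp (v i) -> admissible I (zmnm m - e_ i) (delta_mx 0 i).
  by rewrite mcoeff_msupp => vim; exact: (monomial_field_admissible hD DX vim).
pose W i m : A -> A := hfield (zmnm m - e_ i) (delta_mx 0 i).
have LW : lie_gen S (fun a => \sum_i \sum_(m <- msupp (v i)) (v i)@_m *: W i m a).
  apply: (@lie_gen_sum _ _ _ (fun i a => \sum_(m <- msupp (v i)) (v i)@_m *: W i m a)).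
  move=> i _; apply: (@lie_gen_sum _ _ _ (fun m a => (v i)@_m *: W i m a)) => m mv.
  apply: lie_gen_scale; apply: (hL _ _ (adm _ _ mv)).
  exact/induced_hfield/(adm _ _ mv).
apply: (lie_gen_ext _ LW); apply: (der_ext (lie_gen_derivation hS LW) hD) => j.
rewrite DX [in RHS](mpolyE (v j)) (bigD1 j) //= [X in _ + X]big1 ?addr0.
  rewrite linear_sum /=; apply: eq_big_seq => m mv.
  rewrite /W (induced_Xi _ (induced_hfield (adm _ _ mv))) mxE !eqxx scale1r.
  by rewrite subrK xmon_zmnm linearZ.
move=> i ij; apply: big1_seq => m /= mv.
rewrite /W (induced_Xi _ (induced_hfield (adm _ _ mv))) mxE (eq_sym j) (negbTE ij).
by rewrite andbF scale0r scaler0.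
Qed.

Lemma induced_zero_or_root alpha p D : alpha != 0 -> induced alpha p D ->
  D =1 (fun=> 0) \/ der_root I alpha.
Proof.
move=> a0 iD; case: (classic (exists a, D a != 0)) => [[a Da]|nD].
  by right; apply: induced_root iD Da.
by left=> a; apply/eqP; case: (eqVneq (D a) 0) => // Da; case: nD; exists a.
Qed.

(** A nonzero derivation of outer degree alpha has D(x_j) <> 0 for some j, hence
alpha + e_j has no negative coordinate and alpha_j = -1 is the only negative
coordinate of alpha. Then D vanishes on the other variables and is a nonzero
multiple of d(alpha, e_j^* ). *)
Lemma outer_rootP alpha : der_root I alpha -> outer alpha ->
  exists j, [/\ alpha 0 j = -1, forall l, l != j -> 0 <= alpha 0 l
              & admissible I alpha (delta_mx 0 j)].
Proof.
case=> a0 [D [hD homD [a Da]]] /negP oa.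
have DXE i : exists c, D (pi 'X_i) = c *: pi (xmon k (alpha + e_ i)).
  have [|c ->] := homD (e_ i) (pi 'X_i); last by exists c; rewrite addrC.
  by exists 1; rewrite scale1r -zmnm1 xmon_zmnm.
have [j Dj] : exists j, D (pi 'X_j) != 0.
  apply: NNPP => nD; case/negP: Da; apply/eqP.
  apply: (der_ext hD (der_zero I)) => j; apply/eqP.
  by case: (eqVneq (D (pi 'X_j)) 0) => // Dj; case: nD; exists j.
have neg i : D (pi 'X_i) != 0 -> nonneg (alpha + e_ i).
  have [c ->] := DXE i; rewrite /xmon; case: ifP => // _.
  by rewrite linear0 scaler0 eqxx.
have /nonnegP aj := neg j Dj.
have al l : l != j -> 0 <= alpha 0 l.
  by move=> lj; have := aj l; rewrite mxE e_eq eq_sym (negbTE lj) addr0.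
have ajE : alpha 0 j = -1.
  have := aj j; rewrite mxE e_eq eqxx => aj1.
  have : ~ (0 <= alpha 0 j).
    move=> ajj; apply: oa; apply/nonnegP=> l.
    by case: (eqVneq l j) => [->|/al].
  by move: aj1; move: (alpha 0 j) => x; lia.
exists j; split=> //.
have st c : hder_stable alpha (c *: delta_mx 0 j : 'rV[k]_n).
  move=> m; rewrite pairingZl pairing_delta mulf_eq0 negb_or intr_char0 mxE => /andP[_ mj].
  apply/nonnegP=> l; rewrite !mxE; case: (eqVneq l j) => [->|/al al0].
    by rewrite ajE; move: mj; clear; lia.
  by rewrite addr_ge0.
have [c Dc] := DXE j.
have c0 : c != 0 by apply: contraNneq Dj => c0; rewrite Dc c0 scale0r.
have st1 : hder_stable alpha (delta_mx 0 j : 'rV[k]_n) by rewrite -[X in hder_stable _ X]scale1r.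
split=> // f fI.
have DX i : D (pi 'X_i) = pi (c *: hcoef alpha (delta_mx 0 j) i).
  rewrite /hcoef linearZ /= linearZ /= mxE; case: (eqVneq i j) => [->|ij] /=.
    by rewrite !scale1r Dc.
  rewrite scale0r scaler0; apply/eqP; apply: contraT => /neg /nonnegP /(_ j).
  by rewrite mxE e_eq (negbTE ij) ajE.
have := der_stabilizes hD DX fI.
have -> : vfield (fun i => c *: hcoef alpha (delta_mx 0 j) i) f
        = c *: hder alpha (delta_mx 0 j) f.
  rewrite hder_vfield // /vfield scaler_sumr; apply: eq_bigr => i _.
  by rewrite scalerAl.
by move=> /(idealZ c^-1); rewrite scalerA mulVf // scale1r.
Qed.

End CharZero.
End Monomial.
End Generation.

(** * Roots and their coordinate sums *)

Section MinimalGenerators.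
Variables (n : nat) (k : fieldType) (I : idealr {mpoly k[n]}).
Hypotheses (hchar : [pchar k] =i pred0) (hmon : monomial_ideal I).
Local Notation A := (quotalg I).
Local Notation pi := (qpi I).
Implicit Types (z alpha beta : 'rV[int]_n) (m b : 'X_{1..n}) (p q r : 'rV[k]_n).
Implicit Types (i j l : 'I_n) (D : A -> A).

Hypothesis hcof : cofinite_support I.

Lemma pure_power_in_ideal i : exists d, 'X_[U_(i) *+ d] \in I.
Proof.
have [s hs] := hcof; pose d := (\sum_(z <- s) `|z 0%R i|).+1%N; exists d.
rewrite -xmon_zmnm; set z := zmnm _; have hz : nonneg z by apply: nonneg_zmnm.
apply: contraT => zI; have zs : z \in s.
  by apply: hs => //; apply: contra zI; rewrite /supp /xmon hz.
have : (`|z 0%R i| < d)%N by rewrite ltnS (big_rem z) //= leq_addr.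
by rewrite mxE mulmnE mnm1E eqxx mul1n absz_nat ltnn.
Qed.

(** Otherwise d/dx_i would act on A, and repeated differentiation of a power of x_i
lying in I would bring 1 into I. *)
Lemma opp_e_not_admissible i : ~ admissible I (- e_ i) (delta_mx 0 i).
Proof.
case=> _ sI; have [d] := pure_power_in_ideal i.
elim: d => [|d IH]; first by rewrite mulm0n mpolyX0 idealr1.
move=> /sI; rewrite hderX pairing_delta mxE mulmnE mnm1E eqxx mul1n.
rewrite mulmS zmnmD zmnm1 addrC addKr xmon_zmnm => /(idealZ (d.+1%:R)^-1).
rewrite scalerA -pmulrn mulVf ?scale1r // pmulrn intr_char0 //.
Qed.

Lemma coord_sumD alpha beta :
  \sum_l (alpha + beta) 0 l = \sum_l alpha 0 l + \sum_l beta 0 l.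
Proof. by rewrite -big_split; apply: eq_bigr => l _; rewrite mxE. Qed.

Lemma coord_sum_e i : \sum_l e_ i 0 l = 1 :> int.
Proof.
rewrite (bigD1 i) //= e_eq eqxx big1 ?addr0 // => l lj.
by rewrite e_eq eq_sym (negbTE lj).
Qed.

(** The only negative coordinate of an outer root is a -1, so its coordinate sum is
negative only for some -e_j, which [opp_e_not_admissible] excludes. *)
Lemma root_coord_sum alpha : der_root I alpha ->
  [/\ 0 <= \sum_l alpha 0 l, nonneg alpha -> 0 < \sum_l alpha 0 l
    & ~~ nonneg alpha -> exists2 j, alpha 0 j = -1 & forall l, l != j -> 0 <= alpha 0 l].
Proof.
move=> ra; have a0 : alpha != 0 by case: ra.
have posum z : nonneg z -> z != 0 -> 0 < \sum_l z 0 l.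
  move=> /nonnegP hz z0; rewrite lt0r sumr_ge0 // andbT.
  apply: contraNneq z0 => /eqP; rewrite psumr_eq0 // => /allP h.
  by apply/eqP/rowP=> l; rewrite mxE; apply/eqP/h; rewrite mem_index_enum.
case: (boolP (nonneg alpha)) => ha.
  by split=> [|_|//]; [apply: ltW|]; apply: posum.
have [j [aj al adm]] := outer_rootP hchar ra ha.
split=> [|//|_]; last by exists j.
have h : nonneg (alpha + e_ j).
  apply/nonnegP=> l; rewrite mxE e_eq; case: (eqVneq j l) => [<-|jl].
    by rewrite aj.
  by rewrite addr0 al // eq_sym.
have h0 : alpha + e_ j != 0.
  apply/eqP => /eqP; rewrite addr_eq0 => /eqP aE; move: adm; rewrite aE.
  exact: opp_e_not_admissible.
have := posum _ h h0; rewrite coord_sumD coord_sum_e.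
by move: (\sum_l alpha 0 l) => x; lia.
Qed.

(** * Generation by the outer and the minimal root spaces *)

Variable Emin : {set 'I_n}.
Hypothesis hmin : minimal_roots I Emin.

Definition generators : (A -> A) -> Prop := fun D' =>
  torus D' \/
  exists alpha : 'rV[int]_n,
    [/\ der_root I alpha,
        [\/ outer alpha,
            exists2 i, i \in Emin & alpha = e_ i |
            ~ reducible I alpha /\ exists i, alpha = e_ i + e_ i] &
        gspace alpha D'].

Definition generated m := forall p, reaches (I:=I) generators (zmnm m) p.

Lemma e_neq0 i : (e_ i : 'rV_n) != 0.
Proof. by apply/eqP => /rowP/(_ i); rewrite e_eq eqxx mxE. Qed.

Lemma reaches_outer alpha j : outer alpha -> alpha 0 j = -1 ->
  reaches (I:=I) generators alpha (delta_mx 0 j).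
Proof.
move=> oa aj D iD; have a0 : alpha != 0.
  by apply/eqP => a0; move: aj; rewrite a0 mxE.
case: (induced_zero_or_root a0 iD) => [D0|ra].
  by apply: lie_gen_ext (fsym D0) (lie_gen_zero _).
apply: lie_gen_gen; right; exists alpha; split=> //; first by constructor 1.
exists (delta_mx 0 j); split=> //; rewrite /Nspace /inner (negbTE oa) => l al.
by rewrite mxE (_ : l == j = false) ?andbF //; apply: contraNF al => /eqP ->; rewrite aj.
Qed.

(** The splitting e_j = (e_j - e_i) + e_i is separated by e_i^*, with the values -1
and 1. *)
Lemma generated_e j : generated U_(j).
Proof.
move=> r D iD; have j0 : zmnm U_(j) != 0 by rewrite zmnm1 e_neq0.
case: (induced_zero_or_root j0 iD) => [D0|].
  by apply: lie_gen_ext (fsym D0) (lie_gen_zero _).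
rewrite zmnm1 in iD *; have [h1 h2 _] := hmin.
have Lmin i q : i \in Emin -> reaches generators (e_ i) q.
  move=> iE D' iD'; apply: lie_gen_gen; right; exists (e_ i).
  split; [exact: h1 | by constructor 2; exists i|].
  exact: inner_gspace (nonneg_e i) iD'.
move=> /h2[i [iE [ji|jE]]]; last by rewrite jE in iD; apply: Lmin iD.
have nij : i != j.
  by apply/eqP => ij; case: ji; rewrite ij subrr eqxx.
have aj : (e_ j - e_ i) 0 i = -1.
  by rewrite mxE [X in _ + X]mxE !e_eq eqxx eq_sym (negbTE nij).
have oji : outer (e_ j - e_ i) by apply/negP => /nonnegP /(_ i); rewrite aj.
have [l [al _ adm]] := outer_rootP hchar ji oji.
have li : l = i.
  apply/eqP; apply: contra_eqT al => li.
  rewrite mxE [X in _ + X]mxE !e_eq (eq_sym i) (negbTE li) oppr0 addr0.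
  by case: (j == l).
rewrite li in adm; rewrite -[e_ j](subrK (e_ i)) in iD.
apply: (reaches_sum_delta hmon hchar adm _ (nonneg_e i) _ _ _ iD).
- exact: reaches_outer.
- by move=> q; apply: Lmin.
- by rewrite e_eq eqxx.
- by rewrite aj e_eq eqxx.
Qed.

(** Here m = e_i + b with m_i > 0. The coordinate form at a second index j of the
support takes the values 0 and m_j; if there is none, m = c e_i with c >= 3 and
e_i^* takes the distinct values 1 and c - 1. *)
Lemma generated_step m : (2 <= mdeg m)%N ->
  (forall j, m != U_(j) + U_(j))%MM ->
  (forall b, (0 < mdeg b < mdeg m)%N -> generated b) -> generated m.
Proof.
move=> m2 mn2 IH.
have [i mi] : exists i, (0 < m i)%N.
  apply/existsP; apply: contraLR m2 => /existsPn h.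
  by rewrite mdegE big1 // => i _; apply/eqP; rewrite -leqn0 leqNgt.
set b := (m - U_(i))%MM.
have mE : m = (U_(i) + b)%MM.
  by apply/mnmP=> j; rewrite mnmDE mnmBE mnm1E; case: eqP => [<-|_]; lia.
have bdeg : mdeg m = (mdeg b).+1 by rewrite mE mdegD mdeg1.
have gb : generated b by apply: IH; rewrite bdeg; lia.
have gi : generated U_(i) by apply: IH; rewrite mdeg1; lia.
suff [j [bj0 ij]] : exists j, zmnm b 0 j != 0 /\ zmnm U_(i) 0 j != zmnm b 0 j.
  move=> r; rewrite mE zmnmD.
  apply: (reaches_sum_delta hmon hchar _ _ (nonneg_zmnm b) gb bj0 ij) => //.
  exact/(inner_admissible hmon)/nonneg_zmnm.
case: (classic (exists2 j, j != i & (0 < m j)%N)) => [[j ji mj]|nj].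
  by exists j; rewrite !mxE mnmBE !mnm1E (eq_sym i j) (negbTE ji); split; lia.
have m0 j : j != i -> m j = 0%N.
  by move=> ji; apply/eqP; rewrite -leqn0 leqNgt; apply/negP=> mj; apply: nj; exists j.
have mdi : mdeg m = m i.
  by rewrite mdegE (bigD1 i) //= big1 ?addn0 // => j ji; rewrite m0.
have mi2 : m i != 2.
  apply: contra (mn2 i) => /eqP mi2; apply/eqP/mnmP=> j; rewrite mnmDE mnm1E.
  by case: (eqVneq i j) => [<-|ij]; rewrite ?mi2 // m0 // eq_sym.
by exists i; rewrite !mxE mnmBE !mnm1E eqxx; split; lia.
Qed.

(** Coordinate sums of roots are nonnegative and those of inner roots positive, so
an inner alpha has total degree 1 or 2, and it cannot be 2e_j: beta would be
2e_i - 2e_j, which has coordinate sum 0, so is not inner, and has no coordinate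
equal to -1, so is not outer. *)
Lemma factor_in_lie_gen alpha beta i D : der_root I alpha -> der_root I beta ->
  alpha + beta = e_ i + e_ i -> gspace alpha D -> lie_gen generators D.
Proof.
move=> ra rb ab gD; case: (boolP (nonneg alpha)) => ha; last first.
  by apply: lie_gen_gen; right; exists alpha; split=> //; constructor 1.
have [p [_ iD]] := gD.
have [_ /(_ ha) sa _] := root_coord_sum ra.
have [sb sb0 nb] := root_coord_sum rb.
have sumab : \sum_l alpha 0 l + \sum_l beta 0 l = 2.
  by rewrite -coord_sumD ab coord_sumD !coord_sum_e.
set m := mnmz alpha; have aE : alpha = zmnm m by rewrite mnmzK.
have dE : (mdeg m)%:Z = \sum_l alpha 0 l.
  rewrite aE mdegE; elim/big_ind2: _ => // [x1 x2 y1 y2 <- <-|l _].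
    by rewrite PoszD.
  by rewrite mxE.
suff : generated m by apply; rewrite -aE; exact: iD.
have m2 : (0 < mdeg m <= 2)%N.
  by move: sumab sb sa; rewrite -dE; move: (\sum_l _) => x; lia.
have g1 b : (mdeg b == 1)%N -> generated b.
  by move=> /mdeg1P[j /eqP ->]; apply: generated_e.
case: (eqVneq (mdeg m) 1%N) => [/eqP/g1 //|m1].
apply: generated_step => [|j|b hb]; [lia| |by apply: g1; lia].
apply/eqP => mj; have bE l : beta 0 l = 2 * (i == l)%:Z - 2 * (j == l)%:Z.
  have -> : beta = e_ i + e_ i - (e_ j + e_ j).
    by rewrite -ab aE mj zmnmD zmnm1 addrAC subrr add0r.
  rewrite mxE [X in X + _]mxE [X in _ + X]mxE [X in - X]mxE !e_E; lia.
case: (boolP (nonneg beta)) => hb.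
  have := sb0 hb; move: sumab; rewrite -dE; move: (\sum_l _) => x; lia.
by have [l] := nb hb; rewrite bE; lia.
Qed.

(** Only the reducible case needs an argument, as otherwise 2e_i has zero
derivations only or is one of the generating degrees. *)
Lemma generated_double i : generated (U_(i) + U_(i)).
Proof.
move=> p D iD; have mE : zmnm (U_(i) + U_(i)) = e_ i + e_ i by rewrite zmnmD zmnm1.
rewrite mE in iD; have h2 := nonnegD (nonneg_e i) (nonneg_e i).
have n0 : e_ i + e_ i != 0 :> 'rV_n.
  by apply/eqP => /rowP/(_ i); rewrite mxE e_eq eqxx mxE.
case: (induced_zero_or_root n0 iD) => [D0|r2].
  by apply: lie_gen_ext (fsym D0) (lie_gen_zero _).
have gD := inner_gspace hmon h2 iD.
case: (classic (reducible I (e_ i + e_ i))) => [red|irr]; last first.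
  apply: lie_gen_gen; right; exists (e_ i + e_ i); split=> //.
  by constructor 3; split=> //; exists i.
have := (red D).2 gD; elim=> {D iD gD} [D|||c D _|D D' e _].
- move=> [a [b [D1 [D2 [ra rb ab [g1 g2] e]]]]].
  apply: (lie_gen_ext (fsym e)); apply: lie_gen_bracket.
    exact: (factor_in_lie_gen ra rb ab g1).
  by rewrite addrC in ab; exact: (factor_in_lie_gen rb ra ab g2).
- exact: lie_gen_zero.
- by move=> D1 D2 _ ? _ ?; apply: lie_gen_add.
- exact: lie_gen_scale.
- exact: lie_gen_ext e.
Qed.

Lemma generated_all m : (0 < mdeg m)%N -> generated m.
Proof.
have [d] := ubnP (mdeg m); elim: d m => // d IH m md m0.
case: (eqVneq (mdeg m) 1%N) => [/eqP/mdeg1P[j /eqP ->]|m1]; first exact: generated_e.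
case: (classic (exists j, m = U_(j) + U_(j))%MM) => [[j ->]|nj].
  exact: generated_double.
apply: generated_step => [|j|b /andP[b0 bm]]; first lia.
  by apply/eqP => mj; apply: nj; exists j.
by apply: IH => //; lia.
Qed.

Lemma generators_derivation D : generators D -> derivation D.
Proof. by case=> [[p]|[alpha [_ _ [p [_]]]]]; apply: induced_derivation. Qed.

Lemma generators_generate D : derivation D <-> lie_gen generators D.
Proof.
split=> [hD|]; last exact: lie_gen_derivation generators_derivation.
apply: derivation_in_lie_gen => //; first exact: generators_derivation.
move=> i m adm; case: (boolP (nonneg (zmnm m - e_ i))) => ha; last first.
  apply: reaches_outer => //; move: ha => /negP ha.
  case: (posnP (m i)) => mi.
    by rewrite mxE [X in _ + X]mxE e_eq eqxx mxE mi.
  case: ha; apply/nonnegP => l; rewrite mxE [X in _ + X]mxE e_eq mxE.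
  by case: (eqVneq i l) => [<-|_]; lia.
rewrite -(mnmzK ha) in adm *.
case: (posnP (mdeg (mnmz (zmnm m - e_ i)))) => [/eqP|]; last first.
  by move=> /generated_all; apply.
rewrite mdeg_eq0 => /eqP -> D' iD'; apply: lie_gen_gen; left.
exists (delta_mx 0 i); have <- // : zmnm 0%MM = 0 :> 'rV_n.
by apply/rowP=> l; rewrite !mxE mnm0E.
Qed.

End MinimalGenerators.

Theorem proposition4p10 (k : closedFieldType) (hchar : [pchar k] =i pred0)
  (n : nat) (hn : (0 < n)%N) (I : idealr {mpoly k[n]})
  (hmon : monomial_ideal I) (hcof : cofinite_support I)
  (hx : forall i : 'I_n, 'X_i \notin I)
  (Emin : {set 'I_n}) (hmin : minimal_roots I Emin) :
  forall D : quotalg I -> quotalg I,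
    derivation D <->
    lie_gen (fun D' : quotalg I -> quotalg I =>
      torus D' \/
      exists alpha : 'rV[int]_n,
        [/\ der_root I alpha,
            [\/ outer alpha,
                exists2 i, i \in Emin & alpha = e_ i |
                ~ reducible I alpha /\ exists i, alpha = e_ i + e_ i] &
            gspace alpha D']) D.
Proof. exact: generators_generate. Qed.
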